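(* Let $k$ be a field of characteristic $p>0$ and $G$ a finite group such that $p$ divides $|G|$. Then $D_{reg}$ is an s-projective s-generator in the category $\mathfrak{Ts}_G$.
   Context: $\mathfrak{Ts}_G$ is the category of finitely generated commutative $k$-algebras $A$ on which $G$ acts by $k$-algebra automorphisms such that the trace map $\mathrm{tr}_G: A\to A^G$, $a\mapsto\sum_{g\in G} ag$, is surjective; morphisms are $G$-equivariant $k$-algebra homomorphisms. $D_{reg}=D_{reg}(G):=k[X_g : g\in G]/\big(\sum_{g\in G}X_g-1\big)$, where $G$ acts on the polynomial ring $k[X_g : g\in G]$ by $(X_g)h=X_{gh}$. An object $B\in\mathfrak{Ts}_G$ is s-projective if for every surjective morphism $A\to A'$ in $\mathfrak{Ts}_G$ the induced map $\mathfrak{Ts}_G(B,A)\to\mathfrak{Ts}_G(B,A')$ of morphism sets is surjective. An object $B\in\mathfrak{Ts}_G$ is an s-generator if for every $R\in\mathfrak{Ts}_G$ there are $\ell\ge1$ and a surjective morphism $B^{\otimes \ell}=B\otimes_k\cdots\otimes_k B\to R$ in $\mathfrak{Ts}_G$ (with diagonal $G$-action on $B^{\otimes\ell}$). *)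

(* Defs.v *)
From HB Require Import structures.
From mathcomp Require Import all_boot all_fingroup all_algebra.
From mathcomp Require Import ring_quotient.
From mathcomp.multinomials Require Import freeg mpoly.
From mathcomp Require Import boolp.

Set Implicit Arguments.
Unset Strict Implicit.
Unset Printing Implicit Defensive.

Import GRing.Theory.
Local Open Scope ring_scope.
Local Open Scope quotient_scope.

(* all_fingroup shadows repr. *)
Local Notation qrepr := generic_quotient.repr.

(* A commutative k-algebra is a commutative ring with a ring morphism from k. *)
(* MathComp's comAlgType requires 1 != 0; here the zero algebra is allowed.   *)
Record comPzAlg (k : fieldType) := ComPzAlg {
  alg_ring : comPzRingType;
  alg_unit : {rmorphism k -> alg_ring}
}.

Section AlgebraInstances.
Variables (k : fieldType) (A : comPzAlg k).

Definition alg_sort : Type := alg_ring A.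
HB.instance Definition _ := GRing.ComPzRing.on alg_sort.

Definition alg_scale (c : k) (x : alg_sort) : alg_sort :=
  (alg_unit A c : alg_sort) * x.

Fact alg_scaleA a b v : alg_scale a (alg_scale b v) = alg_scale (a * b) v.
Proof. by rewrite /alg_scale mulrA rmorphM. Qed.
Fact alg_scale1 : left_id 1 alg_scale.
Proof. by move=> v; rewrite /alg_scale rmorph1 mul1r. Qed.
Fact alg_scaleDr : right_distributive alg_scale +%R.
Proof. by move=> c u v; rewrite /alg_scale mulrDr. Qed.
Fact alg_scaleDl v : {morph alg_scale^~ v : a b / a + b}.
Proof. by move=> a b; rewrite /alg_scale rmorphD mulrDl. Qed.

HB.instance Definition _ := GRing.Zmodule_isLmodule.Build k alg_sort
  alg_scaleA alg_scale1 alg_scaleDr alg_scaleDl.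

Lemma alg_scaleE c (x : alg_sort) : c *: x = (alg_unit A c : alg_sort) * x.
Proof. by []. Qed.

Lemma pz_scalerAl (c : k) (x y : alg_sort) : c *: (x * y) = (c *: x) * y.
Proof. exact: mulrA. Qed.

Lemma pz_scalerAr (c : k) (x y : alg_sort) : c *: (x * y) = x * (c *: y).
Proof. by rewrite mulrC pz_scalerAl mulrC. Qed.

End AlgebraInstances.

Coercion alg_sort : comPzAlg >-> Sortclass.

Section AlgebraNotions.
Variable k : fieldType.

Definition alg_hom (A B : comPzAlg k) (f : A -> B) : Prop :=
  [/\ GRing.zmod_morphism f, GRing.monoid_morphism f & scalable f].

Definition subalgebra (A : comPzAlg k) (S : A -> Prop) : Prop :=
  [/\ S 1, forall c x y, S x -> S y -> S (c *: x + y)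
    & forall x y, S x -> S y -> S (x * y)].

Definition finitely_generated (A : comPzAlg k) : Prop :=
  exists s : seq A, forall S : A -> Prop,
    subalgebra S -> (forall x, x \in s -> S x) -> forall a, S a.

Definition surj (A B : Type) (f : A -> B) : Prop := forall b, exists a, f a = b.

End AlgebraNotions.

(* A right action of gT on a k-algebra by k-algebra automorphisms; that each  *)
(* gact^~ g is bijective follows from gact1 and gactM.                        *)
Record gAlg (k : fieldType) (gT : finGroupType) := GAlg {
  galg_sort :> comPzAlg k;
  gact : galg_sort -> gT -> galg_sort;
  gact1 : forall a, gact a 1%g = a;
  gactM : forall a g h, gact a (g * h)%g = gact (gact a g) h;
  gact_alg_hom : forall g, alg_hom (gact^~ g)
}.
Arguments gact {k gT A} _ _ : rename.

Section Category.
Variables (k : fieldType) (gT : finGroupType).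
Implicit Types A B : gAlg k gT.

Definition trace A (a : A) : A := \sum_(g : gT) gact a g.

Definition invariant A (a : A) : Prop := forall g, gact a g = a.

Definition trace_surjective A : Prop :=
  forall a : A, invariant a -> exists b : A, trace b = a.

Definition in_Ts A : Prop := finitely_generated A /\ trace_surjective A.

Definition Ts_morphism A B (f : A -> B) : Prop :=
  [/\ in_Ts A, in_Ts B, alg_hom f & forall a g, f (gact a g) = gact (f a) g].

Definition s_projective B : Prop :=
  in_Ts B /\
  forall (A A' : gAlg k gT) (f : A -> A'), Ts_morphism f -> surj f ->
  forall phi : B -> A', Ts_morphism phi ->
  exists psi : B -> A, Ts_morphism psi /\ forall b, f (psi b) = phi b.

End Category.

Section TensorPower.
Variables (k : fieldType) (A : comPzAlg k) (l : nat).

Local Notation tup := {ffun 'I_l -> A}.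
Local Notation free := {freeg tup / k}.

Definition set_coord (b : tup) (i : 'I_l) (x : A) : tup :=
  [ffun j => if j == i then x else b j].

Definition multilinear (V : lmodType k) (phi : tup -> V) : Prop :=
  forall b i, linear (fun x => phi (set_coord b i x)).

Definition free_gen (b : tup) : free := [freeg [:: (1, b)]].

Definition tensor_rel (r : free) : Prop :=
  exists b i c x y,
    r = free_gen (set_coord b i (c *: x + y))
        - (c *: free_gen (set_coord b i x) + free_gen (set_coord b i y)).

Definition tensor_relspan : {pred free} := fun r =>
  `[< forall S : free -> Prop,
        S 0 -> (forall c u v, S u -> S v -> S (c *: u + v)) ->
        (forall u, tensor_rel u -> S u) -> S r >].

Lemma tensor_relspan_lin c u v :
  u \in tensor_relspan -> v \in tensor_relspan ->
  c *: u + v \in tensor_relspan.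
Proof.
move=> /asboolP hu /asboolP hv; apply/asboolP => S S0 SL SR.
exact: (SL c u v (hu S S0 SL SR) (hv S S0 SL SR)).
Qed.

Lemma tensor_relspan0 : 0 \in tensor_relspan.
Proof. by apply/asboolP => S. Qed.

Lemma tensor_relspan_zmod : zmod_closed tensor_relspan.
Proof.
split=> [|u v hu hv]; first exact: tensor_relspan0.
by rewrite addrC -scaleN1r; apply: tensor_relspan_lin.
Qed.

HB.instance Definition _ :=
  GRing.isZmodClosed.Build free tensor_relspan tensor_relspan_zmod.

(* The tensor power of A over k, as the free k-module on l-tuples modulo the  *)
(* multilinearity relations.                                                  *)
Definition tensor : Type := {ideal_quot tensor_relspan}.
HB.instance Definition _ := GRing.Zmodule.on tensor.

Definition tensor_pi (u : free) : tensor := \pi_{ideal_quot tensor_relspan} u.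

Lemma tensor_piP u v : tensor_pi u = tensor_pi v <-> u - v \in tensor_relspan.
Proof. by rewrite Quotient.idealrBE; split=> [h|/eqP //]; apply/eqP. Qed.

Lemma tensor_piK t : tensor_pi (qrepr (t : {ideal_quot tensor_relspan})) = t.
Proof. exact: reprK. Qed.

Lemma tensor_piB : {morph tensor_pi : u v / u - v}.
Proof. by move=> u v; rewrite /tensor_pi !piE. Qed.

Lemma tensor_piD : {morph tensor_pi : u v / u + v}.
Proof. by move=> u v; rewrite /tensor_pi !piE. Qed.

Definition tensor_scale (c : k) (t : tensor) : tensor :=
  tensor_pi (c *: qrepr (t : {ideal_quot tensor_relspan})).

Lemma tensor_scaleE c u : tensor_scale c (tensor_pi u) = tensor_pi (c *: u).
Proof.
apply/tensor_piP; rewrite -scalerBr -[_ *: _]addr0.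
by apply: tensor_relspan_lin tensor_relspan0; apply/tensor_piP; rewrite tensor_piK.
Qed.

Fact tensor_scaleA a b v :
  tensor_scale a (tensor_scale b v) = tensor_scale (a * b) v.
Proof. by rewrite -[v]tensor_piK !tensor_scaleE scalerA. Qed.
Fact tensor_scale1 : left_id 1 tensor_scale.
Proof. by move=> v; rewrite -[v]tensor_piK tensor_scaleE scale1r. Qed.
Fact tensor_scaleDr : right_distributive tensor_scale +%R.
Proof.
move=> c u v; rewrite -[u]tensor_piK -[v]tensor_piK -tensor_piD !tensor_scaleE.
by rewrite scalerDr tensor_piD.
Qed.
Fact tensor_scaleDl v : {morph tensor_scale^~ v : a b / a + b}.
Proof.
by move=> a b; rewrite -[v]tensor_piK !tensor_scaleE scalerDl tensor_piD.
Qed.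

HB.instance Definition _ := GRing.Zmodule_isLmodule.Build k tensor
  tensor_scaleA tensor_scale1 tensor_scaleDr tensor_scaleDl.

Lemma tensor_piZ c u : tensor_pi (c *: u) = c *: tensor_pi u.
Proof. by rewrite -[RHS]/(tensor_scale _ _) tensor_scaleE. Qed.

(* The class of b 0 (x) b 1 (x) ... (x) b (l - 1). *)
Definition pure (b : tup) : tensor := tensor_pi (free_gen b).

Lemma pure_multilinear : multilinear pure.
Proof.
move=> b i c x y; rewrite /pure -tensor_piZ -tensor_piD; apply/tensor_piP.
by apply/asboolP => S _ _; apply; exists b, i, c, x, y.
Qed.

Lemma tensor_ind (P : tensor -> Prop) :
  P 0 -> (forall c u v, P u -> P v -> P (c *: u + v)) ->
  (forall b, P (pure b)) -> forall t, P t.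
Proof.
move=> P0 PL Pp t; rewrite -[t]tensor_piK.
move: (qrepr _) => u; rewrite -[u]freeg_sumE.
elim: (dom u) => [|b s IH].
  by rewrite big_nil -(scale0r (0 : free)) tensor_piZ scale0r.
rewrite big_cons tensor_piD.
suff -> : << coeff b u *g b >> = coeff b u *: free_gen b.
  by rewrite tensor_piZ; exact: PL _ _ _ (Pp b) IH.
by apply/eqP/freeg_eqP => z; rewrite coeffZ !coeffU mul1r.
Qed.

Section Lift.
Variables (V : lmodType k) (phi : tup -> V).

Lemma fglift_linear : linear (fglift phi).
Proof.
move=> c u v.
have liftD x y : fglift phi (x + y) = fglift phi x + fglift phi y.
  have liftB := @lift_is_additive k tup V phi.
  have l0 : fglift phi 0 = 0 by rewrite -(subrr 0) liftB subrr.
  have lN z : fglift phi (- z) = - fglift phi z by rewrite -sub0r liftB l0 sub0r.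
  by rewrite -{1}[y]opprK liftB lN opprK.
rewrite liftD; congr (_ + _).
have l0 : fglift phi 0 = 0.
  by apply: (@addrI _ (fglift phi 0)); rewrite -liftD !addr0.
rewrite -[u]freeg_sumE; elim: (dom u) => [|b s IH].
  by rewrite big_nil scaler0 l0 scaler0.
rewrite big_cons scalerDr !liftD IH scalerDr; congr (_ + _).
have -> : c *: << coeff b u *g b >> = << c * coeff b u *g b >>.
  by apply/eqP/freeg_eqP => z; rewrite coeffZ !coeffU mulrA.
by rewrite !liftU scalerA.
Qed.

Definition tensor_lift (t : tensor) : V :=
  fglift phi (qrepr (t : {ideal_quot tensor_relspan})).

Hypothesis phi_ml : multilinear phi.

Lemma tensor_lift_pi u : tensor_lift (tensor_pi u) = fglift phi u.
Proof.
have liftB x y : fglift phi (x - y) = fglift phi x - fglift phi y.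
  exact: lift_is_additive.
apply/eqP; rewrite -subr_eq0 -liftB; apply/eqP.
have /tensor_piP/asboolP := tensor_piK (tensor_pi u).
move/(_ (fun x => fglift phi x = 0));
  apply=> [|c x y x0 y0|_ [b [i [c [x [y ->]]]]]].
- by rewrite -(subrr 0) liftB subrr.
- by rewrite fglift_linear x0 y0 scaler0 addr0.
rewrite liftB fglift_linear /free_gen !liftU !scale1r.
by rewrite (phi_ml b i c x y) subrr.
Qed.

Lemma tensor_lift_linear : linear tensor_lift.
Proof.
move=> c u v; rewrite -[u]tensor_piK -[v]tensor_piK -tensor_piZ -tensor_piD.
by rewrite !tensor_lift_pi fglift_linear.
Qed.

Lemma tensor_lift_pure b : tensor_lift (pure b) = phi b.
Proof. by rewrite tensor_lift_pi liftU scale1r. Qed.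

End Lift.

Definition tup_mul (a b : tup) : tup := [ffun i => a i * b i].

Definition tensor_mul (t u : tensor) : tensor :=
  tensor_lift (fun a => tensor_lift (fun b => pure (tup_mul a b)) u) t.

Definition tensor_one : tensor := pure [ffun => 1].

Lemma tup_mulC : commutative tup_mul.
Proof. by move=> a b; apply/ffunP => i; rewrite !ffunE mulrC. Qed.

Lemma tup_mul_set a b i x :
  tup_mul a (set_coord b i x) = set_coord (tup_mul a b) i (a i * x).
Proof. by apply/ffunP => j; rewrite !ffunE; case: eqP => [->|]. Qed.

Lemma pure_mul_multilinear a : multilinear (fun b => pure (tup_mul a b)).
Proof.
move=> b i c x y; rewrite !tup_mul_set mulrDr -pz_scalerAr.
exact: pure_multilinear.
Qed.

Lemma tensor_mul_multilinear u :
  multilinear (fun a => tensor_lift (fun b => pure (tup_mul a b)) u).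
Proof.
have lin a := tensor_lift_linear (pure_mul_multilinear a).
have lift0 a : tensor_lift (fun b => pure (tup_mul a b)) 0 = 0.
  by have := lin a (-1) 0 0; rewrite scaler0 addr0 scaleN1r addNr.
move=> a i c x y; elim/tensor_ind: u => [|d u v hu hv|b].
- by rewrite !lift0 scaler0 addr0.
- rewrite !lin hu hv !scalerDr !scalerA [d * c]mulrC.
  by rewrite addrACA.
have pm := tensor_lift_pure (pure_mul_multilinear _) b.
rewrite !pm ![tup_mul _ b]tup_mulC !tup_mul_set mulrDr -pz_scalerAr.
exact: pure_multilinear.
Qed.

Lemma tensor_mul_pure a b : tensor_mul (pure a) (pure b) = pure (tup_mul a b).
Proof.
rewrite /tensor_mul (tensor_lift_pure (tensor_mul_multilinear _)).
by rewrite (tensor_lift_pure (pure_mul_multilinear _)).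
Qed.

Lemma tensor_mul_linl u : linear (tensor_mul^~ u).
Proof. exact: tensor_lift_linear (tensor_mul_multilinear u). Qed.

Lemma tensor_mul0l u : tensor_mul 0 u = 0.
Proof.
by have := tensor_mul_linl u (-1) 0 0; rewrite scaler0 addr0 scaleN1r addNr.
Qed.

Lemma tensor_mul_pure_linr a : linear (tensor_mul (pure a)).
Proof.
move=> c u v; rewrite /tensor_mul !(tensor_lift_pure (tensor_mul_multilinear _)).
exact: tensor_lift_linear (pure_mul_multilinear a) _ _ _.
Qed.

Lemma tensor_mul_pure0r a : tensor_mul (pure a) 0 = 0.
Proof.
have := tensor_mul_pure_linr a (-1) 0 0.
by rewrite scaler0 addr0 scaleN1r addNr.
Qed.

Fact tensor_mulC : commutative tensor_mul.
Proof.
move=> t u; elim/tensor_ind: t => [|c t t' ht ht'|a].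
- rewrite tensor_mul0l; elim/tensor_ind: u => [|c u u' hu hu'|b].
  + by rewrite tensor_mul0l.
  + by rewrite tensor_mul_linl -hu -hu' scaler0 addr0.
  + by rewrite tensor_mul_pure0r.
- rewrite tensor_mul_linl ht ht' {ht ht'}.
  elim/tensor_ind: u => [|d u u' hu hu'|b].
  + by rewrite !tensor_mul0l scaler0 addr0.
  + rewrite !tensor_mul_linl -hu -hu' !scalerDr !scalerA [d * c]mulrC.
    by rewrite addrACA.
  + by rewrite tensor_mul_pure_linr.
elim/tensor_ind: u => [|d u u' hu hu'|b].
- by rewrite tensor_mul0l tensor_mul_pure0r.
- by rewrite tensor_mul_pure_linr tensor_mul_linl hu hu'.
by rewrite !tensor_mul_pure tup_mulC.
Qed.

Lemma tensor_mul_linr t : linear (tensor_mul t).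
Proof.
by move=> c u v; rewrite tensor_mulC tensor_mul_linl !(tensor_mulC t).
Qed.

Fact tensor_mulA : associative tensor_mul.
Proof.
move=> t u v; elim/tensor_ind: t => [|c t t' ht ht'|a].
- by rewrite !tensor_mul0l.
- by rewrite !tensor_mul_linl ht ht'.
elim/tensor_ind: u => [|c u u' hu hu'|b].
- by rewrite tensor_mul0l tensor_mul_pure0r tensor_mul0l.
- by rewrite tensor_mul_linl !tensor_mul_linr tensor_mul_linl hu hu'.
elim/tensor_ind: v => [|c v v' hv hv'|d].
- by rewrite !tensor_mul_pure0r tensor_mul_pure tensor_mul_pure0r.
- by rewrite !tensor_mul_linr hv hv'.
rewrite !tensor_mul_pure; congr pure.
by apply/ffunP => i; rewrite !ffunE mulrA.
Qed.

Fact tensor_mul1 : left_id tensor_one tensor_mul.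
Proof.
elim/tensor_ind => [|c u v hu hv|b].
- exact: tensor_mul_pure0r.
- by rewrite tensor_mul_linr hu hv.
rewrite tensor_mul_pure; congr pure.
by apply/ffunP => i; rewrite !ffunE mul1r.
Qed.

Fact tensor_mulDl : left_distributive tensor_mul +%R.
Proof.
by move=> t u v; have := tensor_mul_linl v 1 t u; rewrite !scale1r.
Qed.

HB.instance Definition _ := GRing.Zmodule_isComPzRing.Build tensor
  tensor_mulA tensor_mulC tensor_mul1 tensor_mulDl.

Lemma pureM a b : pure a * pure b = pure (tup_mul a b) :> tensor.
Proof. exact: tensor_mul_pure. Qed.

Fact tensor_scalerAl (c : k) (x y : tensor) : c *: (x * y) = (c *: x) * y.
Proof.
have lin := tensor_mul_linl y c x 0; rewrite addr0 tensor_mul0l addr0 in lin.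
exact: esym lin.
Qed.

Definition tensor_unit (c : k) : tensor := c *: tensor_one.

Fact tensor_unit_is_zmod : zmod_morphism tensor_unit.
Proof. by move=> c d; rewrite /tensor_unit scalerBl. Qed.
Fact tensor_unit_is_monoid : monoid_morphism tensor_unit.
Proof.
split=> [|c d]; rewrite /tensor_unit ?scale1r //.
by rewrite -tensor_scalerAl mul1r scalerA.
Qed.
HB.instance Definition _ := GRing.isZmodMorphism.Build k tensor tensor_unit
  tensor_unit_is_zmod.
HB.instance Definition _ := GRing.isMonoidMorphism.Build k tensor tensor_unit
  tensor_unit_is_monoid.

Definition tensor_alg : comPzAlg k := ComPzAlg tensor_unit.

Lemma tensor_algZ c (t : tensor) : c *: (t : tensor_alg) = c *: t.
Proof.
by rewrite alg_scaleE -[LHS]/(tensor_unit c * t) -tensor_scalerAl mul1r.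
Qed.

End TensorPower.

Section TensorPowerAction.
Variables (k : fieldType) (gT : finGroupType) (A : gAlg k gT) (l : nat).

Definition tup_act (b : {ffun 'I_l -> A}) (g : gT) : {ffun 'I_l -> A} :=
  [ffun i => gact (b i) g].

Definition tensor_act (t : tensor A l) (g : gT) : tensor A l :=
  tensor_lift (fun b => pure (tup_act b g)) t.

Lemma tup_act_set b i x g :
  tup_act (set_coord b i x) g = set_coord (tup_act b g) i (gact x g).
Proof. by apply/ffunP => j; rewrite !ffunE; case: eqP. Qed.

Lemma pure_act_multilinear g : multilinear (fun b => pure (tup_act b g)).
Proof.
move=> b i c x y; rewrite !tup_act_set.
have [zf _ sf] := gact_alg_hom A g.
have {}zf (x1 x2 : A) : gact (x1 - x2) g = gact x1 g - gact x2 g by exact: zf.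
have {}sf d (x1 : A) : gact (d *: x1) g = d *: gact x1 g by exact: sf.
have f0 : gact (0 : A) g = 0 by have := zf 0 0; rewrite !subrr.
have -> : gact (c *: x + y) g = c *: gact x g + gact y g.
  rewrite -(sf c x) -{1}[y]opprK zf; congr (_ + _).
  by rewrite -[- y]sub0r zf f0 sub0r opprK.
exact: pure_multilinear.
Qed.

Lemma pure_act b g : tensor_act (pure b) g = pure (tup_act b g).
Proof. exact: tensor_lift_pure (pure_act_multilinear g) b. Qed.

Lemma tensor_act_linear g : linear (tensor_act^~ g).
Proof. exact: tensor_lift_linear (pure_act_multilinear g). Qed.

Lemma tensor_act0 g : tensor_act 0 g = 0.
Proof.
by have := tensor_act_linear g (-1) 0 0; rewrite scaler0 addr0 scaleN1r addNr.
Qed.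

Fact tensor_act1 t : tensor_act t 1%g = t.
Proof.
elim/tensor_ind: t => [|c u v hu hv|b].
- exact: tensor_act0.
- by rewrite tensor_act_linear hu hv.
rewrite pure_act; congr pure.
by apply/ffunP => i; rewrite !ffunE gact1.
Qed.

Fact tensor_actM t :
  forall g h, tensor_act t (g * h)%g = tensor_act (tensor_act t g) h.
Proof.
move=> g h; elim/tensor_ind: t => [|c u v hu hv|b].
- by rewrite !tensor_act0.
- by rewrite !tensor_act_linear hu hv.
rewrite !pure_act; congr pure.
by apply/ffunP => i; rewrite !ffunE gactM.
Qed.

Fact tensor_act_mul g (t u : tensor A l) :
  tensor_act (t * u) g = tensor_act t g * tensor_act u g.
Proof.
have [_ [f1 fM] _] := gact_alg_hom A g.
have lin := tensor_act_linear g.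
elim/tensor_ind: t => [|c t t' ht ht'|a].
- by rewrite mul0r tensor_act0 mul0r.
- by rewrite mulrDl -tensor_scalerAl !lin ht ht' mulrDl tensor_scalerAl.
elim/tensor_ind: u => [|c u u' hu hu'|b].
- by rewrite mulr0 tensor_act0 mulr0.
- rewrite mulrDr [_ * (c *: u)]mulrC -tensor_scalerAl [u * _]mulrC.
  rewrite !lin hu hu' mulrDr; congr (_ + _).
  by rewrite [RHS]mulrC -tensor_scalerAl [_ * tensor_act u g]mulrC.
rewrite pureM !pure_act pureM; congr pure.
by apply/ffunP => i; rewrite !ffunE fM.
Qed.

Fact tensor_act_alg_hom g :
  @alg_hom k (tensor_alg A l) (tensor_alg A l) (tensor_act^~ g).
Proof.
have lin := tensor_act_linear g.
split=> [u v| |c u].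
- by have := lin (-1) v u; rewrite !scaleN1r ![- _ + _]addrC.
- have [_ [f1 _] _] := gact_alg_hom A g.
  split=> [|t u]; last exact: tensor_act_mul.
  rewrite -[1]/(tensor_one A l) /tensor_one pure_act; congr pure.
  by apply/ffunP => i; rewrite !ffunE f1.
by rewrite !tensor_algZ; have := lin c u 0; rewrite addr0 tensor_act0 addr0.
Qed.

Definition tensor_power : gAlg k gT := @GAlg k gT (tensor_alg A l)
  tensor_act tensor_act1 tensor_actM tensor_act_alg_hom.

End TensorPowerAction.

Definition s_generator (k : fieldType) (gT : finGroupType) (B : gAlg k gT) :
    Prop :=
  in_Ts B /\
  forall R : gAlg k gT, in_Ts R ->
  exists (l : nat) (f : tensor_power B l -> R),
    [/\ (1 <= l)%N, Ts_morphism f & surj f].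

Section Dreg.
Variables (k : fieldType) (gT : finGroupType).

(* k[X_g : g in G], its variables being numbered through enum_rank. *)
Definition regpoly := {mpoly k[#|gT|]}.

Definition regX (g : gT) : regpoly := 'X_(enum_rank g).

Definition regpoly_act (q : regpoly) (h : gT) : regpoly :=
  q \mPo [tuple regX (enum_val i * h)%g | i < #|gT|].

Definition Dreg_eqn : regpoly := \sum_(g : gT) regX g - 1.

Definition Dreg_ideal : {pred regpoly} := fun q =>
  `[< exists c : regpoly, q = c * Dreg_eqn >].

Lemma Dreg_idealr : idealr_closed Dreg_ideal.
Proof.
split; first by apply/asboolP; exists 0; rewrite mul0r.
- apply/negP => /asboolP [c] /(congr1 (meval (fun i => (i == enum_rank 1%g)%:R))).
  rewrite rmorph1 rmorphM rmorphB rmorph1 raddf_sum /= (bigD1 1%g) //=.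
  rewrite mevalXU eqxx big1 => [|g ng1].
    by rewrite addr0 subrr mulr0 => /eqP; rewrite oner_eq0.
  by rewrite mevalXU (inj_eq enum_rank_inj) (negbTE ng1).
move=> a u v /asboolP [c ->] /asboolP [d ->]; apply/asboolP.
by exists (a * c + d); rewrite mulrDl mulrA.
Qed.

HB.instance Definition _ := isIdealr.Build regpoly Dreg_ideal Dreg_idealr.

Definition Dreg_sort : Type := {ideal_quot Dreg_ideal}.
HB.instance Definition _ := GRing.ComNzRing.on Dreg_sort.

Definition Dreg_pi (q : regpoly) : Dreg_sort := \pi_{ideal_quot Dreg_ideal} q.

Lemma Dreg_piP p q : Dreg_pi p = Dreg_pi q <-> exists c, p - q = c * Dreg_eqn.
Proof.
split=> [h|h].
  apply/asboolP; rewrite -[asbool _]/(p - q \in Dreg_ideal).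
  by rewrite Quotient.idealrBE; apply/eqP.
by apply/eqP; rewrite -Quotient.idealrBE; apply/asboolP.
Qed.

Lemma Dreg_piK x : Dreg_pi (qrepr (x : {ideal_quot Dreg_ideal})) = x.
Proof. exact: reprK. Qed.

Lemma Dreg_piB : {morph Dreg_pi : p q / p - q}.
Proof. by move=> p q; rewrite /Dreg_pi !piE. Qed.
Lemma Dreg_piD : {morph Dreg_pi : p q / p + q}.
Proof. by move=> p q; rewrite /Dreg_pi !piE. Qed.
Lemma Dreg_piM : {morph Dreg_pi : p q / p * q}.
Proof. by move=> p q; rewrite /Dreg_pi !piE. Qed.
Lemma Dreg_pi1 : Dreg_pi 1 = 1.
Proof. by rewrite /Dreg_pi !piE. Qed.

Definition Dreg_unit (c : k) : Dreg_sort := Dreg_pi c%:MP.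

Fact Dreg_unit_is_zmod : zmod_morphism Dreg_unit.
Proof. by move=> c d; rewrite /Dreg_unit mpolyCB Dreg_piB. Qed.
Fact Dreg_unit_is_monoid : monoid_morphism Dreg_unit.
Proof.
by split=> [|c d]; rewrite /Dreg_unit ?mpolyCM ?Dreg_piM // Dreg_pi1.
Qed.
HB.instance Definition _ := GRing.isZmodMorphism.Build k Dreg_sort Dreg_unit
  Dreg_unit_is_zmod.
HB.instance Definition _ := GRing.isMonoidMorphism.Build k Dreg_sort Dreg_unit
  Dreg_unit_is_monoid.

Definition Dreg_alg : comPzAlg k := ComPzAlg Dreg_unit.

Lemma Dreg_piZ c q : Dreg_pi (c *: q) = c *: (Dreg_pi q : Dreg_alg).
Proof. by rewrite -mul_mpolyC Dreg_piM. Qed.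

Lemma regpoly_actX g h : regpoly_act (regX g) h = regX (g * h)%g.
Proof. by rewrite /regpoly_act comp_mpolyXU -tnth_nth tnth_mktuple enum_rankK. Qed.

Lemma regpoly_act_eqn h : regpoly_act Dreg_eqn h = Dreg_eqn.
Proof.
rewrite /regpoly_act rmorphB rmorph1 raddf_sum /=; congr (_ - _).
rewrite [RHS](reindex_inj (mulIg h)) /=.
by apply: eq_bigr => g _; apply: regpoly_actX.
Qed.

Definition Dreg_act (x : Dreg_sort) (h : gT) : Dreg_sort :=
  Dreg_pi (regpoly_act (qrepr (x : {ideal_quot Dreg_ideal})) h).

Lemma Dreg_act_pi q h : Dreg_act (Dreg_pi q) h = Dreg_pi (regpoly_act q h).
Proof.
apply/Dreg_piP; have /Dreg_piP [c e] := Dreg_piK (Dreg_pi q).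
exists (regpoly_act c h).
by rewrite -(regpoly_act_eqn h) /regpoly_act -rmorphM -rmorphB e.
Qed.

Lemma regpoly_act1 q : regpoly_act q 1%g = q.
Proof.
rewrite /regpoly_act -[RHS]comp_mpoly_id; congr (_ \mPo _).
by apply: eq_mktuple => i; rewrite mulg1 /regX enum_valK.
Qed.

Lemma regpoly_actM q :
  forall g h, regpoly_act q (g * h)%g = regpoly_act (regpoly_act q g) h.
Proof.
move=> g h; rewrite /regpoly_act comp_mpolyE [q \mPo _ in RHS]comp_mpolyE raddf_sum /=.
apply: eq_bigr => m _; rewrite linearZ rmorph_prod /=; congr (_ *: _).
apply: eq_bigr => i _; rewrite rmorphXn /= !tnth_mktuple mulgA; congr (_ ^+ _).
exact: esym (regpoly_actX _ _).
Qed.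

Fact Dreg_act1 x : Dreg_act x 1%g = x.
Proof. by rewrite -[x]Dreg_piK Dreg_act_pi regpoly_act1. Qed.

Fact Dreg_actM x :
  forall g h, Dreg_act x (g * h)%g = Dreg_act (Dreg_act x g) h.
Proof. by move=> g h; rewrite -[x]Dreg_piK !Dreg_act_pi regpoly_actM. Qed.

Fact Dreg_act_alg_hom g : @alg_hom k Dreg_alg Dreg_alg (Dreg_act^~ g).
Proof.
split=> [x y| |c x] /=.
- rewrite -[x]Dreg_piK -[y]Dreg_piK -Dreg_piB !Dreg_act_pi.
  by rewrite /regpoly_act rmorphB Dreg_piB.
- split=> [|x y].
    by rewrite -Dreg_pi1 Dreg_act_pi /regpoly_act rmorph1.
  rewrite -[x]Dreg_piK -[y]Dreg_piK -Dreg_piM !Dreg_act_pi.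
  by rewrite /regpoly_act rmorphM Dreg_piM.
rewrite -[x]Dreg_piK -Dreg_piZ !Dreg_act_pi.
by rewrite /regpoly_act linearZ Dreg_piZ.
Qed.

Definition Dreg : gAlg k gT := @GAlg k gT Dreg_alg
  Dreg_act Dreg_act1 Dreg_actM Dreg_act_alg_hom.

End Dreg.

(* Main.v *)
(* Write tr for the trace. Equivariant homomorphisms from D_reg to A          *)
(* correspond to the elements of A of trace 1, through the image of X_1.      *)
(* Projectivity: if f : A -> A' is onto and tr (f a) = 1, then tr a - 1 is    *)
(* an invariant element of ker f; multiplying it by some b with tr b = 1 and  *)
(* subtracting from a gives a lift of f a of trace 1.                         *)
(* Generation: fix a with tr a = 1. For a generator r of R put t = tr r; then *)
(* a + t and a + r - t a have trace 1, the former because |G| = 0 in k, and   *)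
(* together with a they generate r.                                           *)

Require Import Defs.
From mathcomp Require Import all_boot all_fingroup all_algebra.
From HB Require Import structures.
From mathcomp.multinomials Require Import mpoly.
From mathcomp Require Import boolp.

(* MathComp has its own gact and invariant. *)
Import Defs.

Set Implicit Arguments.
Unset Strict Implicit.
Unset Printing Implicit Defensive.

(** [Dreg] is the free object on one element of trace 1: such an [a] in [A] gives a unique
    equivariant homomorphism with X_1 sent to [a] ([Dreg_hom], [Dreg_hom_eq]). Since the trace is
    linear over invariants, it is onto as soon as 1 is a trace ([trace_surjectiveP]). Hence
    s-projectivity amounts to lifting trace-1 elements along surjections, which is [lift_trace1].
    For generation, a tensor power is a coproduct of algebras ([tensor_hom]), so a nonempty finite
    list of trace-1 elements of R lies in the image of one morphism from a power of [Dreg]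
    ([Dreg_power_hom]). It remains to find such a list generating R as an algebra; invariants have
    trace 0 because p divides |G|, so adding one to a trace-1 element keeps the trace equal to 1. *)

Section AlgHom.
Import GRing.Theory.
Local Open Scope ring_scope.
Variable k : fieldType.
Implicit Types A B C : comPzAlg k.

(** * Algebra homomorphisms and subalgebras *)

Section Morphism.
Variables (A B : comPzAlg k) (f : A -> B).
Hypothesis hf : alg_hom f.

Lemma alg_homB x y : f (x - y) = f x - f y.
Proof. by case: hf => h _ _; apply: h. Qed.

Lemma alg_hom0 : f 0 = 0.
Proof. by rewrite -(subrr 0) alg_homB subrr. Qed.

Lemma alg_homD x y : f (x + y) = f x + f y.
Proof. by rewrite -{1}[y]opprK -(sub0r y) !alg_homB alg_hom0 sub0r opprK. Qed.

Lemma alg_hom1 : f 1 = 1.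
Proof. by case: hf => _ [h _] _. Qed.

Lemma alg_homM x y : f (x * y) = f x * f y.
Proof. by case: hf => _ [_ h] _; apply: h. Qed.

Lemma alg_homZ c x : f (c *: x) = c *: f x.
Proof. by case: hf => _ _ h; apply: h. Qed.

Lemma alg_hom_sum (I : finType) (F : I -> A) :
  f (\sum_i F i) = \sum_i f (F i).
Proof. exact: (big_morph f alg_homD alg_hom0). Qed.

Lemma alg_hom_preim (S : B -> Prop) :
  subalgebra S -> subalgebra (fun x => S (f x)).
Proof.
case=> S1 SL SM; split=> [|c x y Sx Sy|x y Sx Sy].
- by rewrite alg_hom1.
- by rewrite alg_homD alg_homZ; apply: SL.
by rewrite alg_homM; apply: SM.
Qed.

Lemma alg_hom_image : subalgebra (fun y => exists x, f x = y).
Proof.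
split=> [|c _ _ [x <-] [y <-]|_ _ [x <-] [y <-]].
- by exists 1; rewrite alg_hom1.
- by exists (c *: x + y); rewrite alg_homD alg_homZ.
by exists (x * y); rewrite alg_homM.
Qed.

(** Reduces equality and equivariance of homomorphisms to a check on generators. *)
Lemma alg_hom_equalizer g : alg_hom g -> subalgebra (fun x => f x = g x).
Proof.
move=> [gB [g1 gM] gZ]; case: hf => [fB [f1 fM] fZ].
split=> [|c x y e e'|x y e e']; first by rewrite f1 g1.
- have gN z : g (- z) = - g z.
    by rewrite -[- z]sub0r -{1}(subrr 0) !gB subrr sub0r.
  rewrite alg_homD alg_homZ e e'.
  by rewrite -[y in RHS]opprK gB gN opprK (gZ c x).
by rewrite fM gM e e'.
Qed.

End Morphism.

Lemma alg_hom_comp A B C (f : A -> B) (g : B -> C) :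
  alg_hom f -> alg_hom g -> alg_hom (fun x => g (f x)).
Proof.
move=> hf hg; split=> [x y| |c x].
- by rewrite (alg_homB hf) (alg_homB hg).
- split=> [|x y]; first by rewrite (alg_hom1 hf) (alg_hom1 hg).
  by rewrite (alg_homM hf) (alg_homM hg).
by rewrite (alg_homZ hf) (alg_homZ hg).
Qed.

Lemma subalgebraB A (S : A -> Prop) x y :
  subalgebra S -> S x -> S y -> S (x - y).
Proof. by case=> _ SL _ Sx Sy; rewrite addrC -scaleN1r; apply: SL. Qed.

Lemma subalgebraD A (S : A -> Prop) x y :
  subalgebra S -> S x -> S y -> S (x + y).
Proof. by case=> _ SL _ Sx Sy; rewrite -[x]scale1r; apply: SL. Qed.

Lemma subalgebra0 A (S : A -> Prop) : subalgebra S -> S 0.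
Proof. by move=> hS; rewrite -(subrr 1); apply: (subalgebraB hS); case: hS. Qed.

Lemma subalgebra_prod A (S : A -> Prop) (I : finType) (F : I -> A) :
  subalgebra S -> (forall i, S (F i)) -> S (\prod_i F i).
Proof. by move=> [S1 _ SM] SF; apply: (big_ind S). Qed.

(* mmap is only available for nonzero target rings. *)
Lemma mpoly_eval A n (h : 'I_n -> A) :
  exists F : {mpoly k[n]} -> A,
    [/\ GRing.zmod_morphism F, GRing.monoid_morphism F,
        forall c p, F (c *: p) = c *: F p & forall i, F 'X_i = h i].
Proof.
have [z|nz] := eqVneq (1 : A) 0.
  have A0 (x y : A) : x = y by rewrite -[x]mul1r -[y]mul1r z !mul0r.
  by exists (fun=> 0); split=> [p q| |c p|i]; do ?[exact: A0]; split=> [|p q]; exact: A0.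
pose R : comNzRingType := HB.pack (alg_ring A)
  (GRing.PzSemiRing_isNonZero.Build (alg_ring A) nz).
pose u : {rmorphism k -> R} := alg_unit A.
pose F : {rmorphism {mpoly k[n]} -> R} := mmap u (h : 'I_n -> R).
exists F; split.
- by move=> p q; apply: (rmorphB F).
- by split=> [|p q]; [apply: (rmorph1 F) | apply: (rmorphM F)].
- by move=> c p; apply: (@mmapZ n k R h u c p).
by move=> i; rewrite /F /= mmapX mmap1U.
Qed.

End AlgHom.

(** * The trace and its elements of trace 1 *)

Section Trace.
Import GRing.Theory.
Local Open Scope ring_scope.
Variables (k : fieldType) (gT : finGroupType).
Implicit Types A B : gAlg k gT.

Lemma traceD A (a b : A) : trace (a + b) = trace a + trace b.
Proof.
rewrite /trace -big_split; apply: eq_bigr => g _.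
exact: (alg_homD (gact_alg_hom A g)).
Qed.

Lemma traceB A (a b : A) : trace (a - b) = trace a - trace b.
Proof.
rewrite /trace -sumrB; apply: eq_bigr => g _.
exact: (alg_homB (gact_alg_hom A g)).
Qed.

Lemma trace_invariant A (a : A) : invariant (trace a).
Proof.
move=> h; rewrite (alg_hom_sum (gact_alg_hom A h)) [RHS](reindex_inj (mulIg h)).
by apply: eq_bigr => g _; rewrite gactM.
Qed.

Lemma invariant1 A : invariant (1 : A).
Proof. by move=> g; rewrite (alg_hom1 (gact_alg_hom A g)). Qed.

Lemma invariantB A (a b : A) : invariant a -> invariant b -> invariant (a - b).
Proof. by move=> ia ib g; rewrite (alg_homB (gact_alg_hom A g)) ia ib. Qed.

Lemma trace_mulr A (a t : A) : invariant t -> trace (t * a) = t * trace a.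
Proof.
move=> it; rewrite /trace mulr_sumr; apply: eq_bigr => g _.
by rewrite (alg_homM (gact_alg_hom A g)) it.
Qed.

(** All |G| summands equal [t], and |G| is zero in [k]. *)
Lemma trace_of_invariant A (t : A) p :
  p \in [pchar k] -> (p %| #|gT|)%N -> invariant t -> trace t = 0.
Proof.
move=> /andP[_ /eqP p0] /dvdnP[q cG] it.
rewrite /trace (eq_bigr (fun=> t)) => [|g _]; last exact: it.
by rewrite sumr_const cG -scaler_nat natrM p0 mulr0 scale0r.
Qed.

Lemma trace_surjectiveP A : trace_surjective A <-> exists a : A, trace a = 1.
Proof.
split=> [sA|[a ta] t it]; first exact: (sA 1 (@invariant1 A)).
by exists (t * a); rewrite trace_mulr // ta mulr1.
Qed.

Lemma trace_morph A B (f : A -> B) a : alg_hom f ->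
  (forall a g, f (gact a g) = gact (f a) g) -> f (trace a) = trace (f a).
Proof.
by move=> hf fE; rewrite (alg_hom_sum hf); apply: eq_bigr => g _; rewrite fE.
Qed.

Lemma lift_trace1 A B (f : A -> B) b :
  Ts_morphism f -> surj f -> trace b = 1 -> exists2 a, f a = b & trace a = 1.
Proof.
move=> [[_ sA] _ hf fE] sf tb.
have [a0 fa0] := sf b; have [c tc] := (trace_surjectiveP A).1 sA.
pose n := trace a0 - 1.
have nI : invariant n.
  by apply: invariantB; [apply: trace_invariant | apply: invariant1].
have fn : f n = 0.
  by rewrite (alg_homB hf) trace_morph // fa0 tb (alg_hom1 hf) subrr.
(* As [n] is invariant and [c] has trace 1, [n * c] has trace [n]; it is also killed by [f]. *)
exists (a0 - n * c).
  by rewrite (alg_homB hf) (alg_homM hf) fn mul0r subr0.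
by rewrite traceB trace_mulr // tc mulr1 /n subKr.
Qed.

End Trace.

(** * The universal property of [Dreg] and s-projectivity *)

Section DregProperties.
Import GRing.Theory.
Local Open Scope ring_scope.
Variables (k : fieldType) (gT : finGroupType).
Local Notation D := (Dreg k gT).

Definition DregX (g : gT) : D := Dreg_pi (regX k g).

Lemma gact_DregX g h : gact (DregX g) h = DregX (g * h)%g.
Proof. by rewrite /DregX -regpoly_actX -Dreg_act_pi. Qed.

Lemma trace_DregX : trace (DregX 1%g) = 1.
Proof.
rewrite /trace (eq_bigr DregX) => [|g _]; last by rewrite gact_DregX mul1g.
have piS : Dreg_pi (\sum_(g : gT) regX k g) = \sum_g DregX g.
  apply: (big_morph (@Dreg_pi k gT : regpoly k gT -> D) (@Dreg_piD k gT)).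
  by rewrite -(subrr 0) Dreg_piB subrr.
rewrite -piS -[1]/(1 : Dreg_sort k gT) -Dreg_pi1; apply/Dreg_piP.
by exists 1; rewrite mul1r.
Qed.

(** Every class is a linear combination of monomials in the [DregX g]. The form is that of an
    induction principle, so that [elim] can use it. *)
Lemma Dreg_gen (S : D -> Prop) :
  subalgebra S -> (forall g, S (DregX g)) -> forall x, S x.
Proof.
move=> hS SX x.
case: (hS) => S1 SL SM.
have SpiM p q : S (Dreg_pi p) -> S (Dreg_pi q) -> S (Dreg_pi (p * q)).
  by move=> Sp Sq; rewrite Dreg_piM; apply: SM.
have Spi1 : S (Dreg_pi 1) by rewrite Dreg_pi1.
rewrite -[x]Dreg_piK.
elim/mpolyind: (generic_quotient.repr _) => [|c m q _ _ Sq].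
  by rewrite -(subrr 0) Dreg_piB subrr; exact: (subalgebra0 hS).
rewrite Dreg_piD Dreg_piZ; apply: (SL) => //.
rewrite mpolyXE_id; apply: (big_ind (fun r => S (Dreg_pi r))) => // i _.
elim: (m i) => [|j IH]; first by rewrite expr0.
rewrite exprS; apply: SpiM IH.
by rewrite -[i]enum_valK; apply: SX.
Qed.

Lemma Dreg_in_Ts : in_Ts D.
Proof.
split; last by apply/trace_surjectiveP; exists (DregX 1%g); apply: trace_DregX.
exists [seq DregX g | g : gT] => S hS SX; apply: Dreg_gen => // g.
by apply: SX; apply: image_f.
Qed.

(** Evaluation at X_g = [gact a g] sends the relation [Dreg_eqn] to [trace a - 1], so it factors
    through the quotient. *)
Lemma Dreg_hom (A : gAlg k gT) (a : A) : trace a = 1 ->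
  exists f : D -> A, [/\ alg_hom f,
    forall x g, f (gact x g) = gact (f x) g & f (DregX 1%g) = a].
Proof.
move=> ta; pose h (i : 'I_#|gT|) := gact a (enum_val i).
have [F [FB [F1 FM] FZ FX]] := mpoly_eval h.
have FXg g : F (regX k g) = gact a g by rewrite FX /h enum_rankK.
have F0 : F 0 = 0 by rewrite -(subrr 0) FB subrr.
have FD p q : F (p + q) = F p + F q.
  by rewrite -{1}[q]opprK -(sub0r q) !FB F0 sub0r opprK.
have Feqn : F (Dreg_eqn k gT) = 0.
  rewrite FB F1 (big_morph F FD F0) (eq_bigr (gact a)) => [|g _]; last exact: FXg.
  by rewrite -/(trace a) ta subrr.
pose f (x : D) : A := F (generic_quotient.repr (x : {ideal_quot @Dreg_ideal k gT})).
have fpi q : f (Dreg_pi q) = F q.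
  have /Dreg_piP [c e] := Dreg_piK (Dreg_pi q).
  by apply/eqP; rewrite -subr_eq0 -FB e FM Feqn mulr0.
have hf : alg_hom f.
  split=> [x y| |c x].
  - by rewrite -[x]Dreg_piK -[y]Dreg_piK -Dreg_piB !fpi FB.
  - split=> [|x y]; first by rewrite -[1]/(1 : Dreg_sort k gT) -Dreg_pi1 fpi F1.
    by rewrite -[x]Dreg_piK -[y]Dreg_piK -Dreg_piM !fpi FM.
  by rewrite -[x]Dreg_piK -Dreg_piZ !fpi FZ.
exists f; split=> // [x g|]; last by rewrite fpi FXg gact1.
elim/Dreg_gen: x.
  have hfg := alg_hom_comp (gact_alg_hom D g) hf.
  exact: (alg_hom_equalizer hfg (alg_hom_comp hf (gact_alg_hom A g))).
by move=> g'; rewrite gact_DregX !fpi !FXg gactM.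
Qed.

(** The generators X_g form the orbit of X_1. *)
Lemma Dreg_hom_eq (A : gAlg k gT) (f1 f2 : D -> A) :
  alg_hom f1 -> (forall x g, f1 (gact x g) = gact (f1 x) g) ->
  alg_hom f2 -> (forall x g, f2 (gact x g) = gact (f2 x) g) ->
  f1 (DregX 1%g) = f2 (DregX 1%g) -> f1 =1 f2.
Proof.
move=> h1 E1 h2 E2 e x; elim/Dreg_gen: x; first exact: alg_hom_equalizer.
by move=> g; rewrite -[g]mul1g -gact_DregX E1 E2 e.
Qed.

Lemma Dreg_s_projective : s_projective D.
Proof.
split=> [|A A' f fT sf phi [_ _ hphi phiE]]; first exact: Dreg_in_Ts.
have [|a fa ta] := @lift_trace1 _ _ _ _ f (phi (DregX 1%g)) fT sf.
  by rewrite -trace_morph // trace_DregX (alg_hom1 hphi).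
have [psi [hpsi psiE psiX]] := Dreg_hom ta.
case: fT => [AT A'T hf fE].
exists psi; split; first by split=> //; apply: Dreg_in_Ts.
apply: Dreg_hom_eq => //; first exact: alg_hom_comp.
  by move=> x g; rewrite psiE fE.
by rewrite psiX.
Qed.

End DregProperties.

(** * Tensor powers as coproducts *)

Section TensorPowerMorphisms.
Import GRing.Theory.
Local Open Scope ring_scope.
Variables (k : fieldType) (A : comPzAlg k) (l : nat).
Local Notation T := (tensor_alg A l).

(** The i-th coproduct inclusion, x mapping to 1 ⊗ ... ⊗ x ⊗ ... ⊗ 1. *)
Definition tensor_inj (i : 'I_l) (x : A) : T :=
  pure (set_coord [ffun=> 1] i x).

Lemma tensor_inj_alg_hom i : alg_hom (tensor_inj i).
Proof.
have lin c x y : tensor_inj i (c *: x + y) = c *: tensor_inj i x + tensor_inj i y.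
  by rewrite tensor_algZ; apply: pure_multilinear.
have i1 : tensor_inj i 1 = 1.
  rewrite -[RHS]/(tensor_one A l); congr pure.
  by apply/ffunP => j; rewrite !ffunE if_same.
have iB x y : tensor_inj i (x - y) = tensor_inj i x - tensor_inj i y.
  by rewrite addrC -scaleN1r lin scaleN1r addrC.
split=> [x y| |c x]; first exact: iB.
- split=> [|x y] //; rewrite [RHS]pureM; congr pure.
  by apply/ffunP => j; rewrite !ffunE; case: eqP; rewrite ?mulr1.
have i0 : tensor_inj i 0 = 0 by rewrite -(subrr 0) iB subrr.
by have := lin c x 0; rewrite i0 !addr0.
Qed.

Lemma pure_prod b : pure b = \prod_i tensor_inj i (b i) :> T.
Proof.
(* For a general list, coordinate j collects one factor [b j] per occurrence of j; the full
   enumeration contains each j once. *)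
have P (s : seq 'I_l) : \prod_(i <- s) tensor_inj i (b i) =
    pure [ffun j => \prod_(i <- s | i == j) b i] :> T.
  elim: s => [|i s IH].
    by rewrite big_nil; congr pure; apply/ffunP => j; rewrite !ffunE big_nil.
  rewrite big_cons IH [LHS]pureM; congr pure; apply/ffunP => j.
  by rewrite !ffunE big_cons eq_sym; case: eqP => [->|]; rewrite ?mul1r.
rewrite P; congr pure; apply/ffunP => j.
by rewrite ffunE big_pred1_eq.
Qed.

Lemma tensor_gen (S : T -> Prop) :
  subalgebra S -> (forall i x, S (tensor_inj i x)) -> forall t, S t.
Proof.
move=> hS Si; apply: tensor_ind => [|c u v Su Sv|b].
- exact: (subalgebra0 hS).
- by rewrite -tensor_algZ; case: (hS) => _ SL _; apply: SL.
by rewrite pure_prod; apply: subalgebra_prod.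
Qed.

Lemma tensor_hom (B : comPzAlg k) (f : 'I_l -> A -> B) :
  (forall i, alg_hom (f i)) ->
  exists F : T -> B, alg_hom F /\ forall i x, F (tensor_inj i x) = f i x.
Proof.
move=> hf; pose phi (b : {ffun 'I_l -> A}) : B := \prod_i f i (b i).
(* Isolating the i-th factor makes linearity in that coordinate visible. *)
have phi_set b i x :
    phi (set_coord b i x) = f i x * \prod_(j | j != i) f j (b j).
  rewrite /phi (bigD1 i) //= ffunE eqxx; congr (_ * _).
  by apply: eq_bigr => j /negPf ji; rewrite ffunE ji.
have ml : multilinear phi.
  move=> b i c x y; rewrite !phi_set (alg_homD (hf i)) (alg_homZ (hf i)).
  by rewrite mulrDl pz_scalerAl.
pose F : T -> B := tensor_lift phi.
have Fp b : F (pure b) = phi b by exact: tensor_lift_pure.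
have Flin c (u v : T) : F (c *: u + v) = c *: F u + F v.
  by rewrite tensor_algZ; apply: tensor_lift_linear.
have FB u v : F (u - v) = F u - F v.
  by rewrite addrC -scaleN1r Flin scaleN1r addrC.
have F0 : F 0 = 0 by rewrite -(subrr 0) FB subrr.
have FM u v : F (u * v) = F u * F v.
  elim/tensor_ind: u => [|c u u' Hu Hu'|a]; first by rewrite mul0r F0 mul0r.
    rewrite -tensor_algZ mulrDl -[(c *: (u : T)) * v]pz_scalerAl !Flin Hu Hu'.
    by rewrite mulrDl pz_scalerAl.
  elim/tensor_ind: v => [|c v v' Hv Hv'|b]; first by rewrite mulr0 F0 mulr0.
    rewrite -tensor_algZ mulrDr -[_ * (c *: (v : T))]pz_scalerAr !Flin Hv Hv'.
    by rewrite mulrDr pz_scalerAr.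
  rewrite [_ * _ in LHS]pureM !Fp /phi -big_split; apply: eq_bigr => i _.
  by rewrite ffunE (alg_homM (hf i)).
exists F; split=> [|i x]; last first.
  rewrite Fp phi_set big1 ?mulr1 // => j _.
  by rewrite ffunE (alg_hom1 (hf j)).
split=> [u v| |c u]; first exact: FB.
- split=> [|u v]; last exact: FM.
  rewrite -[1]/(tensor_one A l) Fp /phi big1 // => i _.
  by rewrite ffunE (alg_hom1 (hf i)).
by have := Flin c u 0; rewrite F0 !addr0.
Qed.

End TensorPowerMorphisms.

(** * Powers of [Dreg] and generation *)

Section TensorPowerObjects.
Import GRing.Theory.
Local Open Scope ring_scope.
Variables (k : fieldType) (gT : finGroupType).

Lemma gact_tensor_inj (A : gAlg k gT) l i (x : A) g :
  gact (tensor_inj i x : tensor_power A l) g = tensor_inj i (gact x g).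
Proof.
rewrite [LHS]pure_act tup_act_set; congr (pure (set_coord _ _ _)).
by apply/ffunP => j; rewrite !ffunE (alg_hom1 (gact_alg_hom A g)).
Qed.

(** Generators of [A] are placed in every coordinate. The inclusion of the first factor, available
    as [0 < l], is equivariant and so preserves trace 1. *)
Lemma tensor_power_in_Ts (A : gAlg k gT) l :
  (0 < l)%N -> in_Ts A -> in_Ts (tensor_power A l).
Proof.
move=> l0 [[s sA] /trace_surjectiveP[a ta]]; split.
  exists [seq tensor_inj i x | i <- enum 'I_l, x <- s] => S hS SX.
  apply: tensor_gen => // i; apply: sA.
    exact: (alg_hom_preim (tensor_inj_alg_hom A i) hS).
  by move=> x xs; apply: SX; apply: allpairs_f; rewrite ?mem_enum.
apply/trace_surjectiveP; exists (tensor_inj (Ordinal l0) a).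
have hi := tensor_inj_alg_hom A (Ordinal l0).
rewrite -(@trace_morph _ _ A (tensor_power A l) _ _ hi) => [|x g].
  by rewrite ta (alg_hom1 hi).
by rewrite gact_tensor_inj.
Qed.

Lemma Dreg_power_hom (R : gAlg k gT) (s : seq R) :
  in_Ts R -> s != [::] -> (forall a, a \in s -> trace a = 1) ->
  exists F : tensor_power (Dreg k gT) (size s) -> R,
    Ts_morphism F /\ forall a, a \in s -> exists t, F t = a.
Proof.
move=> RT s0 ts.
(* One copy of [Dreg] per entry of [s], its X_1 sent to that entry. *)
have [i|f hf] := @choice _ _ (fun (i : 'I_(size s)) (f : Dreg k gT -> R) =>
    [/\ alg_hom f, forall x g, f (gact x g) = gact (f x) g
      & f (DregX k 1%g) = s`_i]).
  by apply: Dreg_hom; apply: ts; apply: mem_nth.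
have [|F [hF Fi]] := @tensor_hom _ _ _ R f; first by move=> i; case: (hf i).
exists F; split.
  split=> // [|t g].
    by apply: tensor_power_in_Ts; [rewrite lt0n size_eq0 | apply: Dreg_in_Ts].
  pose DT := tensor_power (Dreg k gT) (size s).
  elim/tensor_gen: t.
    have hFg := alg_hom_comp (gact_alg_hom DT g) hF.
    exact: (alg_hom_equalizer hFg (alg_hom_comp hF (gact_alg_hom R g))).
  by move=> i x; rewrite gact_tensor_inj !Fi; case: (hf i) => _ ->.
move=> a /(nthP 0)[i is_ <-].
exists (tensor_inj (Ordinal is_) (DregX k 1%g)).
by rewrite Fi; case: (hf (Ordinal is_)) => _ _ ->.
Qed.

Lemma Dreg_s_generator p :
  p \in [pchar k] -> (p %| #|gT|)%N -> s_generator (Dreg k gT).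
Proof.
move=> pk pG; split=> [|R RT]; first exact: Dreg_in_Ts.
have [[s sR] /trace_surjectiveP[a ta]] := RT.
pose u r : R := a + trace r; pose v r : R := a + (r - trace r * a).
(* The head [a] keeps the list nonempty even when [s] is empty. *)
have [| |F [FT FS]] := @Dreg_power_hom R (a :: map u s ++ map v s) RT.
- by [].
- move=> x; rewrite inE mem_cat => /or3P[/eqP -> //|/mapP[r _ ->]|/mapP[r _ ->]].
    rewrite traceD ta (trace_of_invariant pk pG) ?addr0 //.
    exact: trace_invariant.
  rewrite traceD traceB trace_mulr ?ta ?mulr1 ?subrr ?addr0 //.
  exact: trace_invariant.
exists (size (a :: map u s ++ map v s)), F; split=> //.
case: (FT) => _ _ hF _; have hI := alg_hom_image hF.
apply: sR => // r rs.
have Ia := FS a (mem_head _ _).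
have Iu : exists t, F t = u r by apply: FS; rewrite inE mem_cat map_f ?orbT.
have Iv : exists t, F t = v r by apply: FS; rewrite inE mem_cat orbC map_f ?orbT.
(* The generator is recovered from [trace r = u r - a] and [r = (v r - a) + trace r * a]. *)
have It : exists t, F t = trace r.
  by rewrite -[trace r](addKr a) addrC; apply: (subalgebraB hI).
have -> : r = (v r - a) + trace r * a by rewrite /v [_ - a]addrC addKr subrK.
apply: (subalgebraD hI); first exact: (subalgebraB hI).
by case: hI => _ _; apply.
Qed.

End TensorPowerObjects.

Theorem lemma2p15 (k : fieldType) (p : nat) (gT : finGroupType) :
  p \in [pchar k]%R -> p %| #|gT| ->
  s_projective (Dreg k gT) /\ s_generator (Dreg k gT).
Proof.
move=> pk pG; split; first exact: Dreg_s_projective.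
exact: Dreg_s_generator pk pG.
Qed.
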